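(* Let $H$ be a non-zero complex Hilbert space and let $Q\in\mathbb{B}(H)$ be a quadratic operator. Then the following statements are equivalent: (i) $Q$ attains its norm; (ii) for any $c,k\in\mathbb{C}$, the operator $Q+cQ^*+kI$ attains its norm; (iii) there exist $c,k\in\mathbb{C}$ such that the operator $Q+cQ^*+kI$ attains its norm.
   Context: $\mathbb{B}(H)$ denotes the set of bounded linear operators on $H$, $I$ is the identity operator on $H$, and $Q^*$ is the adjoint of $Q$. An operator $Q\in\mathbb{B}(H)$ is quadratic if $(Q-aI)(Q-bI)=0$ for some $a,b\in\mathbb{C}$. A bounded linear operator $B$ between Hilbert spaces attains its norm if there is a unit vector $x$ in its domain with $\|Bx\|=\|B\|$. *)

(* Defs.v *)
From HB Require Import structures.
From mathcomp Require Import all_boot all_order all_algebra.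
From mathcomp Require Export complex.
From mathcomp Require Import all_classical all_reals all_analysis.

Set Implicit Arguments.
Unset Strict Implicit.
Unset Printing Implicit Defensive.

Import Order.TTheory GRing.Theory Num.Theory.
Import numFieldNormedType.Exports.

Local Open Scope classical_set_scope.
Local Open Scope complex_scope.
Local Open Scope ring_scope.

(* The complex field is R[i], for R : realType; norms therefore take their
   (real, nonnegative) values in R[i]. The inner product is linear in its first
   argument and conjugate-linear in its second one. *)
HB.mixin Record CompleteNormedModule_isHilbert (R : realType) H
    & CompleteNormedModule R[i] H := {
  inner : {dot H for @Num.conj R[i]} ;
  inner_norm : forall x : H, inner x x = `|x| ^+ 2
}.

#[short(type="hilbertType")]
HB.structure Definition Hilbert (R : realType) :=
  {H of CompleteNormedModule R[i] H & CompleteNormedModule_isHilbert R H}.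

Section operators.
Variable R : realType.

Definition bounded_operator (U V : hilbertType R) (B : {linear U -> V}) : Prop :=
  bounded_near B (nbhs (0 : U)).

(* Re `|B x| is `|B x| seen as an element of R. *)
Definition opnorm (U V : hilbertType R) (B : U -> V) : R :=
  sup [set complex.Re `|B x| | x in [set x : U | `|x| <= 1]].

Definition attains_norm (U V : hilbertType R) (B : U -> V) : Prop :=
  exists2 x : U, `|x| = 1 & `|B x| = (opnorm B)%:C.

Definition quadratic (H : hilbertType R) (Q : {linear H -> H}) : Prop :=
  exists a b : R[i],
    (Q \- a \*: idfun) \o (Q \- b \*: idfun) =1 (fun=> 0).

(* The value at y is the vector representing x |-> <Q x, y>. It is unique by
   definiteness, and exists by the Riesz representation theorem when Q is
   bounded; the default value 0 is then never used. *)
Definition adjoint (H : hilbertType R) (Q : H -> H) : H -> H :=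
  fun y => xget 0 [set z | forall x, inner (Q x) y = inner x z].

Lemma adjoint_unique (H : hilbertType R) (Q Qs : H -> H) :
  (forall x y, inner (Q x) y = inner x (Qs y)) -> adjoint Q = Qs.
Proof.
move=> QsE; apply/funext => y; apply: xget_unique => [x|z zE]; first exact: QsE.
apply/eqP; rewrite -subr_eq0; apply/negPn/negP => /neq0_dnorm_gt0.
by move=> /(_ _ inner); rewrite linearB/= -zE -QsE subrr ltxx.
Qed.

End operators.

(* Main.v *)
Require Import Defs.
From mathcomp Require Import all_boot all_order all_algebra.
From mathcomp Require Import all_classical all_reals all_analysis.
From mathcomp Require Import ring lra.
Import Order.TTheory GRing.Theory Num.Theory.
Import numFieldNormedType.Exports.
Set Implicit Arguments.
Unset Strict Implicit.
Unset Printing Implicit Defensive.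
Local Open Scope classical_set_scope.
Local Open Scope complex_scope.
Local Open Scope ring_scope.

(** Write the quadratic relation as (Q - a)(Q - b) = 0, let K be the kernel
    of Q - a, L its orthogonal complement and H = K + L. Since Q - b maps H into
    K, Q is a I on K and b I + P on L, where P = Q - b maps L into K. Taking
    adjoints, T = Q + c Q^* + k I is the block operator
      T (u + v) = (alpha u + P v) + (beta v + c P^* u)     (u in K, v in L)
    with alpha = a + c a^* + k and beta = b + c b^* + k. The theorem follows
    from the fact that T attains its norm if and only if P attains its supremum
    p over the unit ball of L, a condition in which c and k do not occur
    ([attains_norm_block]); the operator Q itself is the case c = k = 0.

    With gamma = alpha + beta^* c, expanding the squared norm gives
      |T (u + v)|^2 = |alpha|^2 |u|^2 + |beta|^2 |v|^2 + |P v|^2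
                      + |c|^2 |P^* u|^2 + 2 Re (gamma <u, P v>),
    which is at most the real binary quadratic form
      F_p (s, t) = (|alpha|^2 + |c|^2 p^2) s^2 + (|beta|^2 + p^2) t^2
                   + 2 |gamma| p s t
    at (s, t) = (|u|, |v|). Conversely, if v in L is a unit vector and q = |P v|
    is positive, then for s, t >= 0 a suitable multiple u of P v, of norm s,
    makes |T (u + t v)|^2 at least F_q (s, t).

    Suppose p > 0. The two bounds show that the square of the norm of T is the
    maximum of F_p on the unit circle. If P attains p at v, the second bound
    with q = p shows that T attains its norm. If T attains its norm at u + v,
    the estimates behind the first bound are equalities there, so |P v| = p |v|.
    When v is non-zero, P attains p at v / |v|. When v = 0, either c is non-zero
    and P attains p at P^* u / p, or the maximum of F_p would be |alpha|^2, which
    is too small. If p = 0, the operator T is diagonal, and both conditions hold.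

    The adjoint of Q exists by the Riesz representation theorem, and the
    splitting H = K + L is the projection theorem; both are derived here from
    completeness by the parallelogram law. *)

(** * Real-valued norms and the inner product *)

(** Norms are elements of R[i], which is only partially ordered; the estimates
    below compare squares of norms in the real field. *)
Definition nrm (R : realType) (V : normedZmodType R[i]) (x : V) : R :=
  complex.Re `|x|.

Section real_norm.
Variable R : realType.

Section normedZmod.
Variable V : normedZmodType R[i].
Implicit Types x y : V.

Lemma nrmE x : `|x| = (nrm x)%:C.
Proof. by rewrite /nrm RRe_real// ger0_real. Qed.

Lemma nrm_ge0 x : 0 <= nrm x.
Proof. by rewrite -ler0c -nrmE. Qed.

Lemma nrm0 : nrm (0 : V) = 0.
Proof. by rewrite /nrm normr0. Qed.

Lemma nrm_eq0 x : (nrm x == 0) = (x == 0).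
Proof.
by rewrite -(normr_eq0 x) nrmE -(inj_eq (@complexI R)).
Qed.

Lemma nrmD x y : nrm (x + y) <= nrm x + nrm y.
Proof. by rewrite -lecR rmorphD/= -!nrmE ler_normD. Qed.

Lemma nrmN x : nrm (- x) = nrm x.
Proof. by rewrite /nrm normrN. Qed.

Lemma nrmB x y : nrm (x - y) = nrm (y - x).
Proof. by rewrite -nrmN opprB. Qed.
End normedZmod.

Lemma nrm1 : nrm (1 : R[i]) = 1.
Proof. by rewrite /nrm normr1. Qed.

Lemma nrm_real (r : R) : nrm (r%:C : R[i]) = `|r|.
Proof. by rewrite /nrm normc_def/= expr0n addr0 sqrtr_sqr. Qed.

Lemma nrmM (a b : R[i]) : nrm (a * b) = nrm a * nrm b.
Proof. by apply: complexI; rewrite rmorphM/= -!nrmE normrM. Qed.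

Lemma nrmJ (a : R[i]) : nrm (a^* )%C = nrm a.
Proof. by rewrite /nrm normcJ. Qed.

Lemma ReD (a b : R[i]) : complex.Re (a + b) = complex.Re a + complex.Re b.
Proof. by case: a b => [? ?] []. Qed.

Lemma conjcM (a b : R[i]) : (a * b)^*%C = a^*%C * b^*%C.
Proof. exact: rmorphM. Qed.

Lemma nrmZ (H : normedModType R[i]) a (x : H) : nrm (a *: x) = nrm a * nrm x.
Proof. by apply: complexI; rewrite rmorphM/= -!nrmE normrZ. Qed.

Lemma mulJ_nrm (a : R[i]) : a * a^*%C = (nrm a ^+ 2)%:C.
Proof. by rewrite -sqr_normc nrmE rmorphXn. Qed.

End real_norm.

Section inner_product.
Variables (R : realType) (H : hilbertType R).
Implicit Types (x y z : H) (a : R[i]).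

Lemma innerC x y : inner x y = (inner y x)^*%C.
Proof. by rewrite hermC/= expr0 mul1r. Qed.

Lemma innerDl x y z : inner (x + y) z = inner x z + inner y z.
Proof. exact: linearDl. Qed.
Lemma innerBl x y z : inner (x - y) z = inner x z - inner y z.
Proof. exact: linearBl. Qed.
Lemma innerZl a x y : inner (a *: x) y = a * inner x y.
Proof. exact: linearZl_LR. Qed.
Lemma innerDr x y z : inner x (y + z) = inner x y + inner x z.
Proof. exact: linearDr. Qed.
Lemma innerBr x y z : inner x (y - z) = inner x y - inner x z.
Proof. exact: linearBr. Qed.
Lemma innerZr a x y : inner x (a *: y) = a^*%C * inner x y.
Proof. exact: linearZr_LR. Qed.

Lemma inner_nrm x : inner x x = (nrm x ^+ 2)%:C.
Proof. by rewrite inner_norm nrmE rmorphXn. Qed.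

Lemma Re_innerC x y : complex.Re (inner x y) = complex.Re (inner y x).
Proof. by rewrite innerC; case: (inner y x). Qed.

Lemma nrm_sqrD x y :
  nrm (x + y) ^+ 2 = nrm x ^+ 2 + nrm y ^+ 2 + 2 * complex.Re (inner x y).
Proof.
have := inner_nrm (x + y); rewrite innerDl !innerDr !inner_nrm.
move=> /(congr1 (@complex.Re R)); rewrite /= !raddfD/= (Re_innerC y x).
by move=> <-; ring.
Qed.

Lemma nrm_sqrB x y :
  nrm (x - y) ^+ 2 = nrm x ^+ 2 + nrm y ^+ 2 - 2 * complex.Re (inner x y).
Proof. by rewrite nrm_sqrD nrmN linearNr raddfN/= mulrN. Qed.

Lemma pythagoras x y : inner x y = 0 ->
  nrm (x + y) ^+ 2 = nrm x ^+ 2 + nrm y ^+ 2.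
Proof. by move=> xy; rewrite nrm_sqrD xy mulr0 addr0. Qed.

(** Cauchy-Schwarz for the real part: expand the squared norm of
    |y| x - |x| y. *)
Lemma Re_inner_le x y : complex.Re (inner x y) <= nrm x * nrm y.
Proof.
have [/eqP|x0] := eqVneq (nrm x) 0.
  by rewrite nrm_eq0 => /eqP ->; rewrite linear0l nrm0 mul0r.
have [/eqP|y0] := eqVneq (nrm y) 0.
  by rewrite nrm_eq0 => /eqP ->; rewrite linear0r nrm0 mulr0.
have xy0 : 0 < nrm x * nrm y by rewrite mulr_gt0// lt_def ?x0 ?y0 nrm_ge0.
have := sqr_ge0 (nrm ((nrm y)%:C *: x - (nrm x)%:C *: y)).
rewrite nrm_sqrB !nrmZ !nrm_real !ger0_norm ?nrm_ge0// innerZl innerZr conjc_real.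
rewrite mulrA -rmorphM/= -complexr0.
case: (inner x y) => p q; rewrite /= => h.
suff: 0 <= 2 * (nrm x * nrm y) * (nrm x * nrm y - p).
  by rewrite pmulr_rge0 ?subr_ge0// mulr_gt0.
by lra.
Qed.

Lemma inner_injr y z : (forall x, inner x y = inner x z) -> y = z.
Proof.
move=> yz; apply/eqP; rewrite -subr_eq0 -nrm_eq0 -sqrf_eq0.
by rewrite -(inj_eq (@complexI R)) -inner_nrm innerBr yz subrr.
Qed.
End inner_product.

(** * Orthogonal projection onto a closed subspace *)

Section projection.
Variables (R : realType) (H : hilbertType R).

Lemma gt0_complexP (e : R[i]) : 0 < e -> exists2 r : R, 0 < r & e = r%:C.
Proof.
move=> e0; exists (complex.Re e); last by rewrite RRe_real// gtr0_real.
by move: e0; rewrite ltcE => /andP[].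
Qed.

Lemma norm_ltP (V : normedZmodType R[i]) (x : V) (r : R) :
  (`|x| < r%:C) = (nrm x < r).
Proof. by rewrite nrmE ltcR. Qed.

Lemma parallelogram (x y : H) :
  nrm (x + y) ^+ 2 + nrm (x - y) ^+ 2 = 2 * nrm x ^+ 2 + 2 * nrm y ^+ 2.
Proof. by rewrite nrm_sqrD nrm_sqrB; ring. Qed.

(** The parallelogram law makes minimizing sequences for the distance from x
    to a subspace Cauchy: the midpoint of k and k' cannot be closer to x than
    the infimum m. *)
Lemma minimizing_near (K : set H) (m : R) (x k k' : H) (e e' : R) :
  (forall u v, K u -> K v -> K (u + v)) -> (forall a u, K u -> K (a *: u)) ->
  (forall u, K u -> m <= nrm (x - u) ^+ 2) ->
  K k -> K k' -> nrm (x - k) ^+ 2 <= m + e -> nrm (x - k') ^+ 2 <= m + e' ->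
  nrm (k - k') ^+ 2 <= 2 * e + 2 * e'.
Proof.
move=> KD KZ mK kK k'K ke k'e.
have /mK : K ((2^-1 : R)%:C *: (k + k')) by apply/KZ/KD.
have := parallelogram (x - k) (x - k').
rewrite (_ : x - k - (x - k') = k' - k); last by rewrite opprB addrC addrA subrK.
have -> : x - k + (x - k') = (2 : R)%:C *: (x - (2^-1 : R)%:C *: (k + k')).
  rewrite scalerBr scalerA -rmorphM/= divff// scale1r.
  by rewrite rmorph_nat scaler_nat mulr2n opprD addrACA.
rewrite nrmZ nrm_real ger0_norm// exprMn (nrmB k').
lra.
Qed.

Lemma closest_point (K : set H) (x : H) :
  closed K -> K 0 ->
  (forall u v, K u -> K v -> K (u + v)) -> (forall a u, K u -> K (a *: u)) ->
  exists2 u, K u & forall w, K w -> nrm (x - u) <= nrm (x - w).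
Proof.
move=> Kcl K0 KD KZ.
pose D := [set nrm (x - u) ^+ 2 | u in K].
have Dinf : has_inf D.
  split; first by exists (nrm (x - 0) ^+ 2), 0.
  by exists 0 => _ [u _ <-]; exact: sqr_ge0.
have mK u : K u -> inf D <= nrm (x - u) ^+ 2.
  by move=> uK; apply: ge_inf; [case: Dinf|exists u].
have /choice[k kP] n : exists u, K u /\ nrm (x - u) ^+ 2 <= inf D + n.+1%:R^-1.
  have [|_ [u uK <-] ue] := @inf_adherent R D (n.+1%:R^-1) _ Dinf.
    by rewrite invr_gt0.
  by exists u; split=> //; exact: ltW.
have kn (e : R) : 0 < e -> \forall n \near \oo, n.+1%:R^-1 < e :> R.
  move=> e0; exact: (near_infty_natSinv_lt (PosNum e0)).
have kcau : cauchy (k @ \oo).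
  apply: cauchy_exP => _ /gt0_complexP[e e0 ->].
  have e40 : 0 < e ^+ 2 / 4 by rewrite divr_gt0// exprn_gt0.
  have [N _ /(_ N (leqnn N)) Ne] := kn _ e40.
  exists (k N); suff: \forall n \near \oo, ball (k N) e%:C (k n) by [].
  near=> n; rewrite -ball_normE/= norm_ltP.
  rewrite -(ltr_pXn2r (_ : (0 < 2)%N))// ?nnegrE ?nrm_ge0 ?ltW//.
  have [kN1 kN2] := kP N; have [kn1 kn2] := kP n.
  have := minimizing_near KD KZ mK kN1 kn1 kN2 kn2.
  have : n.+1%:R^-1 < e ^+ 2 / 4 :> R by near: n; exact: kn.
  move: Ne => /=.
  by move: N.+1%:R^-1 n.+1%:R^-1 (nrm _ ^+ 2) (e ^+ 2) => p q r s; lra.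
have /cvg_ex[l kl] : cvg (k @ \oo) by exact: cauchy_cvg.
exists l.
  by apply: (closed_cvg _ Kcl _ _ kl); apply: nearW => n; case: (kP n).
move=> w wK; apply/ler_addgt0Pr => e e0.
have e20 : 0 < e / 2 by rewrite divr_gt0.
near \oo => n.
have [k1 k2] := kP n.
have ln : nrm (l - k n) < e / 2.
  rewrite -norm_ltP; near: n; move/cvgrPdist_lt: kl; apply.
  by rewrite ltcR.
have xn : nrm (x - k n) <= nrm (x - w) + e / 2.
  rewrite -(@ler_pXn2r _ 2%N)// ?nnegrE ?addr_ge0 ?nrm_ge0 ?(ltW e20)//.
  have n2 : n.+1%:R^-1 < (e / 2) ^+ 2 :> R.
    by near: n; apply: kn; rewrite exprn_gt0.
  rewrite sqrrD (le_trans k2)// lerD//; last exact: ltW.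
  rewrite (le_trans (mK _ wK))//.
  by rewrite lerDl mulrn_wge0// mulr_ge0 ?nrm_ge0 ?(ltW e20).
have := nrmD (x - k n) (k n - l); rewrite addrA subrK (nrmB (k n)); lra.
Unshelve. all: by end_near. Qed.

Definition orthogonal_set (K : set H) : set H :=
  [set v | forall u, K u -> inner u v = 0].

(** If u is a point of K closest to x, then moving u along k in K by the
    small multiple s z^* of k, where z = <k, x - u>, would decrease the distance
    unless z = 0. *)
Lemma orthogonal_decomposition (K : set H) (x : H) :
  closed K -> K 0 ->
  (forall u v, K u -> K v -> K (u + v)) -> (forall a u, K u -> K (a *: u)) ->
  exists u v, [/\ K u, orthogonal_set K v & x = u + v].
Proof.
move=> Kcl K0 KD KZ; have [u uK umin] := closest_point x Kcl K0 KD KZ.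
exists u, (x - u); split => //; last by rewrite addrC subrK.
move=> k kK; set v := x - u; set z := inner k v.
(* any s with 0 < s < 2 / |k|^2 works; this one also covers k = 0 *)
pose s := (1 + nrm k ^+ 2)^-1.
have k1 : 0 < 1 + nrm k ^+ 2 by rewrite ltr_pwDl// sqr_ge0.
have /umin : K (u + (s%:C * z^*%C) *: k) by apply/KD/KZ.
rewrite opprD addrA -/v -(@ler_pXn2r _ 2%N)// ?nnegrE ?nrm_ge0//.
rewrite (nrm_sqrB v) nrmZ nrmM nrm_real nrmJ innerZr conjcM conjcK conjc_real.
rewrite (innerC v) -/z -(mulrA s%:C) mulJ_nrm -rmorphM/= ger0_norm ?invr_ge0 ?(ltW k1)//.
rewrite exprMn exprMn => h.
have {h} : nrm z ^+ 2 * (s * (2 - s * nrm k ^+ 2)) <= 0 by lra.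
have s0 : 0 < s by rewrite invr_gt0.
have sk : s * nrm k ^+ 2 <= 1 by rewrite /s mulrC ler_pdivrMr// mul1r lerDr.
rewrite pmulr_lle0; last by rewrite mulr_gt0//; lra.
by rewrite le_eqVlt sqrf_eq0 nrm_eq0 ltNge sqr_ge0 orbF => /eqP.
Qed.

Lemma closed_ker (V : normedZmodType R[i]) (f : H -> V) (C : R) :
  (forall x y, nrm (f x - f y) <= C * nrm (x - y)) ->
  closed [set x | f x = 0].
Proof.
move=> fC x clx; apply/eqP; rewrite -nrm_eq0 eq_le nrm_ge0 andbT.
apply/ler_addgt0Pr => e e0; rewrite add0r.
have C1 : 0 < `|C| + 1 by rewrite ltr_wpDl.
have eC : 0 < e / (`|C| + 1) by rewrite divr_gt0.
have eCC : 0 < (e / (`|C| + 1))%:C :> R[i] by rewrite ltcR.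
have [y [/= fy]] := clx _ (nbhsx_ballx x _ eCC).
rewrite -ball_normE/= norm_ltP ltr_pdivlMr// => xye.
rewrite -[f x]subr0 -fy (le_trans (fC x y))// (le_trans _ (ltW xye))//.
by rewrite mulrC ler_wpM2l ?nrm_ge0// (le_trans (ler_norm C))// lerDl.
Qed.
End projection.

(** * Riesz representation and the adjoint *)

Section riesz.
Variables (R : realType) (H : hilbertType R).

(** The complex inequality reduces to the real part after multiplying x by
    the conjugate of <x, y>. *)
Lemma cauchy_schwarz (x y : H) : nrm (inner x y) <= nrm x * nrm y.
Proof.
set z := inner x y; have [/eqP|z0] := eqVneq (nrm z) 0.
  by rewrite nrm_eq0 => /eqP ->; rewrite nrm0 mulr_ge0 ?nrm_ge0.
have z_gt0 : 0 < nrm z by rewrite lt_def z0 nrm_ge0.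
have := Re_inner_le (z^*%C *: x) y.
rewrite innerZl -/z mulrC mulJ_nrm nrmZ nrmJ /= expr2 -mulrA.
by rewrite ler_pM2l.
Qed.

(** A non-zero functional is represented by a multiple of any vector v
    orthogonal to its kernel, because x - (phi x / phi v) v lies in that
    kernel. *)
Lemma riesz (phi : H -> R[i]) (C : R) :
  scalar phi -> (forall x, nrm (phi x) <= C * nrm x) ->
  exists z, forall x, phi x = inner x z.
Proof.
move=> lphi bphi.
have phi0 : phi 0 = 0.
  by apply/eqP; rewrite -nrm_eq0 eq_le nrm_ge0 andbT -(mulr0 C) -(nrm0 H) bphi.
have phiD x y : phi (x + y) = phi x + phi y.
  by have := lphi 1 x y; rewrite scale1r mul1r.
have phiZ a x : phi (a *: x) = a * phi x.
  by have := lphi a x 0; rewrite !addr0 phi0 addr0.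
have phiB x y : phi (x - y) = phi x - phi y.
  by rewrite -scaleN1r phiD phiZ mulN1r.
have [z0|/existsNP[x0 /eqP x00]] := pselect (forall x, phi x = 0).
  by exists 0 => x; rewrite z0 linear0r.
have [] := @orthogonal_decomposition _ _ [set x | phi x = 0] x0.
- by apply: (@closed_ker _ _ _ _ C) => x y; rewrite -phiB.
- exact: phi0.
- by move=> x y /= px py; rewrite phiD px py addr0.
- by move=> a x /= px; rewrite phiZ px mulr0.
move=> u [v [/= pu vK x0E]].
have pv : phi v != 0 by move: x00; rewrite x0E phiD pu add0r.
have v0 : (nrm v ^+ 2)%:C != 0 :> R[i].
  rewrite (inj_eq (@complexI R)) sqrf_eq0 nrm_eq0.
  by apply: contraNneq pv => ->; rewrite phi0.
exists ((phi v / (nrm v ^+ 2)%:C)^*%C *: v) => x; rewrite innerZr conjcK.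
have : inner (x - (phi x / phi v) *: v) v = 0.
  by apply: vK; rewrite /= phiB phiZ divfK// subrr.
rewrite innerBl innerZl inner_nrm => /eqP; rewrite subr_eq0 => /eqP ->.
by move: _%:C v0 => N N0; field; rewrite pv N0.
Qed.

Lemma bounded_operatorP (Q : {linear H -> H}) : bounded_operator Q ->
  exists2 C, 0 <= C & forall x, nrm (Q x) <= C * nrm x.
Proof.
move=> /linear_boundedP /pinfty_ex_gt0[_ /gt0_complexP[C C0 ->] QC].
by exists C => [|x]; [exact: ltW|rewrite -lecR rmorphM/= -!nrmE QC].
Qed.

(** Existence of the adjoint: the vector at w represents the bounded functional
    that sends x to <Q x, w>. *)
Lemma adjointP (Q : {linear H -> H}) (x y : H) : bounded_operator Q ->
  inner (Q x) y = inner x (adjoint Q y).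
Proof.
move=> /bounded_operatorP[C C0 QC].
suff /choice[Qs QsE] : forall w, exists z, forall x, inner (Q x) w = inner x z.
  by rewrite (adjoint_unique (fun x y => QsE y x)).
move=> w; apply: (@riesz _ (C * nrm w)) => [a u v|u].
  by rewrite linearP innerDl innerZl.
rewrite (le_trans (cauchy_schwarz _ _))// mulrAC.
by rewrite ler_wpM2r ?nrm_ge0.
Qed.
End riesz.

(** * Maximum of a binary quadratic form on the unit circle *)

Section quadratic_form.
Variable R : rcfType.

(** The maximizer is a unit eigenvector, for the largest eigenvalue l, of the
    symmetric matrix with diagonal A, B and off-diagonal entry g. As g >= 0, it
    can be taken in the first quadrant, so that its coordinates are possible
    norms of vectors. The inequality holds because
    (l - A) (l (x^2 + y^2) - A x^2 - B y^2 - 2 g x y) is the square of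
    (l - A) x - g y. *)
Lemma quadratic_form_max (A B g : R) : 0 <= g ->
  exists s t, [/\ 0 <= s, 0 <= t, s ^+ 2 + t ^+ 2 = 1 &
    forall x y, A * x ^+ 2 + B * y ^+ 2 + 2 * g * (x * y) <=
      (A * s ^+ 2 + B * t ^+ 2 + 2 * g * (s * t)) * (x ^+ 2 + y ^+ 2)].
Proof.
rewrite le_eqVlt => /predU1P[<-|g0].
  have [AB|/ltW BA] := leP A B.
    exists 0, 1; split; rewrite ?ler01 ?expr0n ?expr1n /= ?add0r// => x y.
    have := ler_wpM2r (sqr_ge0 x) AB; lra.
  exists 1, 0; split; rewrite ?ler01 ?expr0n ?expr1n /= ?addr0// => x y.
  have := ler_wpM2r (sqr_ge0 y) BA; lra.
pose d := Num.sqrt ((A - B) ^+ 2 + 4 * g ^+ 2).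
have dE : d ^+ 2 = (A - B) ^+ 2 + 4 * g ^+ 2.
  by rewrite sqr_sqrtr// addr_ge0 ?sqr_ge0// mulr_ge0 ?sqr_ge0.
have dAB : A - B < d.
  have [|BA] := leP (A - B) 0.
    move=> /le_lt_trans; apply; rewrite sqrtr_gt0 ltr_wpDl ?sqr_ge0//.
    by rewrite mulr_gt0 ?exprn_gt0.
  rewrite -(ltr_pXn2r (_ : (0 < 2)%N))// ?nnegrE ?sqrtr_ge0 ?ltW// dE.
  by have := exprn_gt0 2 g0; lra.
(* l is the largest eigenvalue, m = l - A, and (g, m) is an eigenvector *)
pose m := (B - A + d) / 2; pose l := A + m.
have m0 : 0 < m by rewrite divr_gt0//; lra.
have mE : m * (l - B) = g ^+ 2.
  rewrite (_ : m * (l - B) = (d ^+ 2 - (A - B) ^+ 2) / 4); last first.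
    by rewrite /l /m; field.
  by rewrite dE; field.
pose N := Num.sqrt (g ^+ 2 + m ^+ 2).
have N2 : N ^+ 2 = g ^+ 2 + m ^+ 2 by rewrite sqr_sqrtr// addr_ge0 ?sqr_ge0.
have N0 : 0 < N by rewrite sqrtr_gt0 addr_gt0 ?exprn_gt0.
exists (g / N), (m / N); split.
- by rewrite divr_ge0 ?ltW.
- by rewrite divr_ge0 ?ltW.
- by rewrite (expr_div_n g) (expr_div_n m) -mulrDl -N2 divff// expf_neq0// gt_eqF.
have -> : A * (g / N) ^+ 2 + B * (m / N) ^+ 2 + 2 * g * (g / N * (m / N)) = l.
  rewrite (_ : _ + _ = (A * g ^+ 2 + B * m ^+ 2 + 2 * g ^+ 2 * m) / N ^+ 2).
    rewrite (_ : A * _ + _ + _ = l * N ^+ 2) ?mulfK// ?expf_neq0 ?gt_eqF//.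
    rewrite N2 mulrDr -mE /l; ring.
  by field; rewrite gt_eqF.
move=> x y; rewrite -subr_ge0 -(pmulr_rge0 _ m0).
rewrite (_ : m * _ = (m * x - g * y) ^+ 2) ?sqr_ge0//.
have -> : (m * x - g * y) ^+ 2 =
    m ^+ 2 * x ^+ 2 - 2 * g * m * (x * y) + (m * (l - B)) * y ^+ 2.
  by rewrite mE; ring.
by rewrite /l; ring.
Qed.
End quadratic_form.

(** * Attaining the norm *)

Section norm_attainment.
Variables (R : realType) (H : hilbertType R).

(** The bound C guarantees that the supremum defining the operator norm is
    that of a bounded set, hence dominates its elements. *)
Lemma attains_normP (T : H -> H) (C : R) :
  (forall x, nrm x <= 1 -> nrm (T x) <= C) ->
  attains_norm T <->
  exists2 e, nrm e = 1 & forall x, nrm x <= 1 -> nrm (T x) <= nrm (T e).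
Proof.
move=> TC.
have ball1 (x : H) : (`|x| <= 1) = (nrm x <= 1) by rewrite nrmE lecR.
have unit1 (x : H) : `|x| = 1 <-> nrm x = 1.
  by rewrite nrmE; split => [/complexI|->].
split=> -[e e1 Te]; exists e; try exact/unit1.
- move=> x x1; rewrite -lecR -!nrmE Te nrmE lecR /opnorm.
  apply: ub_le_sup; last by exists x => //=; rewrite ball1.
  by exists C => _ [y /= y1 <-]; apply: TC; rewrite -ball1.
- rewrite nrmE; congr _%:C; apply/le_anti/andP; split.
    apply: ub_le_sup; last by exists e => //=; rewrite ball1 e1.
    by exists C => _ [y /= y1 <-]; apply: TC; rewrite -ball1.
  apply: ge_sup; first by exists (nrm (T e)), e => //=; rewrite ball1 e1.
  by move=> _ [x /= x1 <-]; apply: Te; rewrite -ball1.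
Qed.

Lemma phaseP (z : R[i]) : exists2 w, nrm w = 1 & z * w = (nrm z)%:C.
Proof.
have [->|z0] := eqVneq z 0; first by exists 1; rewrite ?nrm1// mul0r nrm0.
have nz0 : (nrm z)%:C != 0 :> R[i] by rewrite (inj_eq (@complexI R)) nrm_eq0.
exists (z^*%C * ((nrm z)^-1)%:C).
  rewrite nrmM nrmJ nrm_real ger0_norm ?invr_ge0 ?nrm_ge0// divff//.
  by rewrite nrm_eq0.
rewrite mulrA mulJ_nrm -rmorphM/= expr2 mulfK// nrm_eq0//.
Qed.

Lemma unit_or_trivial (X : set H) : (forall a x, X x -> X (a *: x)) ->
  (exists2 x, X x & nrm x = 1) \/ (forall x, X x -> nrm x = 0).
Proof.
move=> XZ; have [|/existsNP[x /not_implyP[xX /eqP x0]]] :=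
  pselect (forall x, X x -> nrm x = 0); first by right.
left; exists (((nrm x)^-1)%:C *: x); first exact: XZ.
by rewrite nrmZ nrm_real ger0_norm ?invr_ge0 ?nrm_ge0// mulVf.
Qed.

End norm_attainment.

(** The ball is used rather than the sphere so that the condition holds when
    L is zero or P vanishes on L. *)
Definition attains_max_on (R : realType) (H : hilbertType R)
    (L : set H) (P : H -> H) :=
  exists2 v, L v /\ nrm v <= 1 &
    forall w, L w -> nrm w <= 1 -> nrm (P w) <= nrm (P v).

(** The form F_q: a, b, c and g stand for the moduli of alpha, beta, c and
    gamma, and q for a value or a bound of |P v| on unit vectors. *)
Definition block_form (R : realType) (a b c g q s t : R) : R :=
  (a ^+ 2 + c ^+ 2 * q ^+ 2) * s ^+ 2 + (b ^+ 2 + q ^+ 2) * t ^+ 2 +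
  2 * (g * q) * (s * t).

(** * Block operators with adjoint corners *)

Section block_operator.
Variables (R : realType) (H : hilbertType R) (K L : set H).
Variables (P S T : H -> H) (al be c : R[i]).
Hypothesis KZ : forall a u, K u -> K (a *: u).
Hypothesis LZ : forall a v, L v -> L (a *: v).
Hypothesis KL_ortho : forall u v, K u -> L v -> inner u v = 0.
Hypothesis KL_sum : forall x, exists u v, [/\ K u, L v & x = u + v].
Hypothesis PK : forall v, L v -> K (P v).
Hypothesis SL : forall u, K u -> L (S u).
Hypothesis PZ : forall a v, L v -> P (a *: v) = a *: P v.
Hypothesis P_bounded : exists C, forall v, L v -> nrm v <= 1 -> nrm (P v) <= C.
Hypothesis PS_adjoint : forall u v, K u -> L v -> inner (P v) u = inner v (S u).
Hypothesis TE : forall u v, K u -> L v ->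
  T (u + v) = (al *: u + P v) + (be *: v + c *: S u).

Let K0 : K 0.
Proof. by have [u [v [uK _ _]]] := KL_sum 0; rewrite -(scale0r u); exact: KZ. Qed.

Let L0 : L 0.
Proof. by have [u [v [_ vL _]]] := KL_sum 0; rewrite -(scale0r v); exact: LZ. Qed.

Let P0 : P 0 = 0.
Proof. by have := PZ 0 L0; rewrite !scale0r. Qed.

Let nrm_sum u v : K u -> L v -> nrm (u + v) ^+ 2 = nrm u ^+ 2 + nrm v ^+ 2.
Proof. by move=> uK vL; apply/pythagoras/KL_ortho. Qed.

Let p : R := sup [set nrm (P v) | v in [set v | L v /\ nrm v <= 1]].

Let le_p v : L v -> nrm v <= 1 -> nrm (P v) <= p.
Proof.
move=> vL v1; apply: ub_le_sup; last by exists v.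
by have [C PC] := P_bounded; exists C => _ [w [wL w1] <-]; exact: PC.
Qed.

Let p_le M : (forall v, L v -> nrm v <= 1 -> nrm (P v) <= M) -> p <= M.
Proof.
move=> PM; apply: ge_sup; last by move=> _ [w [wL w1] <-]; exact: PM.
by exists (nrm (P 0)), 0 => //; split => //; rewrite nrm0.
Qed.

Let p_ge0 : 0 <= p.
Proof. by rewrite -(nrm0 H) -P0 le_p// nrm0. Qed.

Let nrm_scale_inv (r : R) (x : H) : 0 < r -> nrm ((r^-1)%:C *: x) = nrm x / r.
Proof.
by move=> r0; rewrite nrmZ nrm_real ger0_norm ?invr_ge0 ?ltW// mulrC.
Qed.

Let P_le v : L v -> nrm (P v) <= p * nrm v.
Proof.
move=> vL; have [v0|v0] := eqVneq (nrm v) 0.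
  have /eqP := v0; rewrite nrm_eq0 => /eqP ->.
  by rewrite P0 !nrm0 mulr0.
have v_gt0 : 0 < nrm v by rewrite lt_def v0 nrm_ge0.
rewrite -ler_pdivrMr// -nrm_scale_inv// -PZ//.
by apply: le_p; [exact: LZ|rewrite nrm_scale_inv// divff].
Qed.

(* |S u|^2 = <S u, S u> = <P (S u), u> *)
Let S_le u : K u -> nrm (S u) <= p * nrm u.
Proof.
move=> uK; have [->|Su0] := eqVneq (nrm (S u)) 0.
  by rewrite mulr_ge0 ?nrm_ge0.
have Su_gt0 : 0 < nrm (S u) by rewrite lt_def Su0 nrm_ge0.
rewrite -(ler_pM2l Su_gt0) -expr2.
have -> : nrm (S u) ^+ 2 = complex.Re (inner (P (S u)) u).
  by rewrite PS_adjoint ?inner_nrm//; exact: SL.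
rewrite (le_trans (Re_inner_le _ _))// mulrCA mulrA ler_wpM2r ?nrm_ge0//.
exact/P_le/SL.
Qed.

Let g : R[i] := al + be^*%C * c.

(** The two cross terms combine, since <v, S u> = <P v, u> is the conjugate of
    <u, P v>: this is where g comes from. *)
Lemma nrm_block_sqr u v : K u -> L v ->
  nrm (T (u + v)) ^+ 2 =
  nrm al ^+ 2 * nrm u ^+ 2 + nrm be ^+ 2 * nrm v ^+ 2 +
  nrm (P v) ^+ 2 + nrm c ^+ 2 * nrm (S u) ^+ 2 +
  2 * complex.Re (g * inner u (P v)).
Proof.
move=> uK vL; rewrite TE// pythagoras; last first.
  rewrite innerDl !innerDr !KL_ortho ?addr0//;
  do ?[exact: KZ|exact: LZ|exact: PK|exact: SL];
  by apply: LZ; exact: SL.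
rewrite !nrm_sqrD !nrmZ !innerZl innerZr -PS_adjoint//.
have -> : complex.Re (be * (c^*%C * inner (P v) u)) =
    complex.Re (be^*%C * c * inner u (P v)).
  rewrite (innerC u) -[in RHS](conjcK c) -!conjcM -mulrA.
  by case: (be * _).
by rewrite /g (mulrDl al) ReD !exprMn; ring.
Qed.

Let form := block_form (nrm al) (nrm be) (nrm c) (nrm g).

(** These are the three estimates behind the bound by F_p; the case of equality
    in the first two identifies the vectors at which P is maximal. *)
Lemma nrm_block_le u v : K u -> L v ->
  [/\ nrm (P v) ^+ 2 <= p ^+ 2 * nrm v ^+ 2,
      nrm (S u) ^+ 2 <= p ^+ 2 * nrm u ^+ 2 &
      complex.Re (g * inner u (P v)) <= nrm g * p * (nrm u * nrm v)].
Proof.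
move=> uK vL; split.
- by rewrite -exprMn ler_pXn2r ?nnegrE ?mulr_ge0 ?nrm_ge0// P_le.
- by rewrite -exprMn ler_pXn2r ?nnegrE ?mulr_ge0 ?nrm_ge0// S_le.
rewrite -innerZl (le_trans (Re_inner_le _ _))// nrmZ.
rewrite -!mulrA ler_wpM2l ?nrm_ge0// (mulrCA p) ler_wpM2l ?nrm_ge0//.
exact: P_le.
Qed.

Lemma nrm_block_le_form u v : K u -> L v ->
  nrm (T (u + v)) ^+ 2 <= form p (nrm u) (nrm v).
Proof.
move=> uK vL; have [Pv Su gP] := nrm_block_le uK vL.
have cSu := ler_wpM2l (sqr_ge0 (nrm c)) Su.
rewrite nrm_block_sqr// /form /block_form; lra.
Qed.

(** Take u of norm s along P v, with a phase w that makes Re (g <u, P v>) equal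
    to |g| s q. Pairing S u with v shows |S u| >= s q, which bounds the remaining
    term from below. *)
Lemma form_le_nrm_block v (s t : R) : L v -> nrm v = 1 -> 0 < nrm (P v) ->
  0 <= s -> 0 <= t -> s ^+ 2 + t ^+ 2 = 1 ->
  exists2 x, nrm x = 1 & form (nrm (P v)) s t <= nrm (T x) ^+ 2.
Proof.
move=> vL v1; set q := nrm (P v) => q0 s0 t0 st1.
have [w w1 gw] := phaseP g.
pose u := ((s / q)%:C * w) *: P v.
have uK : K u by apply/KZ/PK.
have us : nrm u = s.
  have sq0 : 0 <= s / q by rewrite divr_ge0// ltW.
  by rewrite nrmZ nrmM w1 mulr1 nrm_real ger0_norm// -/q divfK// gt_eqF.
have tvL : L (t%:C *: v) by exact: LZ.
have tvt : nrm (t%:C *: v) = t by rewrite nrmZ v1 mulr1 nrm_real ger0_norm.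
exists (u + t%:C *: v).
  apply/eqP; rewrite -(@eqrXn2 _ 2%N)// ?nrm_ge0// expr1n.
  by rewrite nrm_sum// us tvt st1.
rewrite nrm_block_sqr// us tvt PZ// nrmZ nrm_real ger0_norm// -/q.
have gu : complex.Re (g * inner u (t%:C *: P v)) = nrm g * q * (s * t).
  rewrite innerZl innerZr conjc_real inner_nrm -/q.
  rewrite (_ : _ * _ = (g * w) * ((s / q)%:C * (t%:C * (q ^+ 2)%:C))); last ring.
  by rewrite gw -!rmorphM/=; field; rewrite gt_eqF.
have Su : s * q <= nrm (S u).
  have := Re_inner_le (w *: v) (S u).
  rewrite nrmZ w1 v1 !mul1r; apply: le_trans.
  rewrite innerZl -PS_adjoint// innerZr conjcM conjc_real inner_nrm -/q.
  rewrite (_ : _ * _ = (w * w^*%C) * ((s / q)%:C * (q ^+ 2)%:C)); last ring.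
  rewrite mulJ_nrm w1 -!rmorphM/= expr1n mul1r le_eqVlt; apply/orP; left.
  by apply/eqP; field; rewrite gt_eqF.
have Su2 : (s * q) ^+ 2 <= nrm (S u) ^+ 2.
  by rewrite ler_pXn2r ?nnegrE ?nrm_ge0 ?mulr_ge0// ltW.
have cSu := ler_wpM2l (sqr_ge0 (nrm c)) Su2.
rewrite gu /form /block_form; lra.
Qed.

(* The vectors v with P v = 0 are left out because the lower bound for |T x|
   needs the direction of P v. *)
Let affine_le_sup (D M : R) : 0 < p -> 0 <= D ->
  (forall v, L v -> nrm v = 1 -> 0 < nrm (P v) -> D * nrm (P v) <= M) ->
  D * p <= M.
Proof.
move=> p0 D0 DM.
have DM' v : L v -> nrm v <= 1 -> 0 < nrm (P v) -> D * nrm (P v) <= M.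
  move=> vL v1 Pv0.
  have v0 : 0 < nrm v.
    rewrite lt_def nrm_ge0 andbT nrm_eq0; apply: contraTneq Pv0 => ->.
    by rewrite P0 nrm0 ltxx.
  have := DM ((nrm v)^-1%:C *: v) (LZ _ vL).
  rewrite PZ// !nrm_scale_inv// divff ?gt_eqF// => /(_ erefl).
  rewrite divr_gt0// mulrA ler_pdivrMr// => /(_ isT) /le_trans; apply.
  rewrite ler_piMr//; apply: le_trans (DM ((nrm v)^-1%:C *: v) (LZ _ vL) _ _).
  - by rewrite mulr_ge0 ?nrm_ge0.
  - by rewrite nrm_scale_inv// divff ?gt_eqF.
  - by rewrite PZ// nrm_scale_inv// divr_gt0.
have M0 : 0 <= M.
  apply/negP => M0; suff : p <= 0 by rewrite leNgt p0.
  apply: p_le => v vL v1; rewrite leNgt; apply/negP => Pv0; apply: M0.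
  by apply: le_trans (DM' _ vL v1 Pv0); rewrite mulr_ge0 ?nrm_ge0.
move: D0; rewrite le_eqVlt => /predU1P[<-|D0]; first by rewrite mul0r.
rewrite mulrC -ler_pdivlMr//; apply: p_le => v vL v1.
have [Pv0|] := ltP 0 (nrm (P v)); first by rewrite ler_pdivlMr// mulrC DM'.
by move=> /le_trans; apply; rewrite divr_ge0// ltW.
Qed.

Let max_form : exists s t : R, [/\ 0 <= s, 0 <= t, s ^+ 2 + t ^+ 2 = 1 &
  forall x y, form p x y <= form p s t * (x ^+ 2 + y ^+ 2)].
Proof. by apply: quadratic_form_max; rewrite mulr_ge0 ?nrm_ge0. Qed.

Let nrm_le_max (s t : R) :
  (forall x y, form p x y <= form p s t * (x ^+ 2 + y ^+ 2)) ->
  forall x, nrm (T x) ^+ 2 <= form p s t * nrm x ^+ 2.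
Proof.
move=> st x; have [u [v [uK vL ->]]] := KL_sum x.
by rewrite nrm_sum// (le_trans (nrm_block_le_form uK vL)).
Qed.

Let form_ge0 (q s t : R) : 0 <= q -> 0 <= s -> 0 <= t -> 0 <= form q s t.
Proof.
move=> q0 s0 t0; rewrite /form /block_form.
by do ?[done|exact: sqr_ge0|exact: nrm_ge0|apply: addr_ge0|apply: mulr_ge0].
Qed.

Let T_bounded : exists C, forall x, nrm x <= 1 -> nrm (T x) <= C.
Proof.
have [s [t [s0 t0 _ st]]] := max_form; exists (1 + form p s t) => x x1.
have := nrm_le_max st x; have := nrm_ge0 (T x).
have : form p s t * nrm x ^+ 2 <= form p s t.
  by rewrite ler_piMr ?form_ge0// expr_le1// nrm_ge0.
nra.
Qed.

(** For unit v in L, q = |P v| satisfies F_q (s, t) <= |T e|^2. As F_q (s, t)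
    is convex in q, it lies above its tangent at q = p; the resulting inequality
    D q <= M is affine in q and passes to the supremum p, where the tangent
    meets the curve. *)
Lemma form_le_attained (e : H) (s t : R) : 0 < p ->
  (forall x, nrm x <= 1 -> nrm (T x) <= nrm (T e)) ->
  0 <= s -> 0 <= t -> s ^+ 2 + t ^+ 2 = 1 -> form p s t <= nrm (T e) ^+ 2.
Proof.
move=> p0 Te s0 t0 st1.
pose C := nrm c ^+ 2 * s ^+ 2 + t ^+ 2.
have C0 : 0 <= C by rewrite addr_ge0 ?sqr_ge0// mulr_ge0 ?sqr_ge0.
pose D := 2 * nrm g * (s * t) + 2 * p * C.
have formE q : form q s t = nrm al ^+ 2 * s ^+ 2 + nrm be ^+ 2 * t ^+ 2 +
    2 * nrm g * (s * t) * q + C * q ^+ 2.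
  by rewrite /form /block_form /C; ring.
suff : D * p <= nrm (T e) ^+ 2 - nrm al ^+ 2 * s ^+ 2 - nrm be ^+ 2 * t ^+ 2
                + C * p ^+ 2 by rewrite formE /D; lra.
apply: affine_le_sup => //.
  by rewrite addr_ge0// !mulr_ge0// ?nrm_ge0// ltW.
move=> v vL v1 Pv0.
have [x x1] := form_le_nrm_block vL v1 Pv0 s0 t0 st1.
have : nrm (T x) ^+ 2 <= nrm (T e) ^+ 2.
  by rewrite ler_pXn2r ?nnegrE ?nrm_ge0// Te// x1.
have := mulr_ge0 C0 (sqr_ge0 (nrm (P v) - p)).
rewrite formE /D; lra.
Qed.

(** At a maximizing vector u + v of T, the squared norm equals the upper bound
    F_p, so |P v| = p |v| and |c| |S u| = |c| p |u|. *)
Lemma corner_max_of_norm_max (e : H) : 0 < p -> nrm e = 1 ->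
  (forall x, nrm x <= 1 -> nrm (T x) <= nrm (T e)) -> attains_max_on L P.
Proof.
move=> p0 e1 Te.
have p2 : 0 < p ^+ 2 by rewrite exprn_gt0.
suff [w [wL w1 Pw]] : exists w, [/\ L w, nrm w <= 1 & p <= nrm (P w)].
  by exists w => // x xL x1; rewrite (le_trans _ Pw)// le_p.
have [s0 [t0 [s0_ge0 t0_ge0 st1 st_max]]] := max_form.
have max_le := form_le_attained p0 Te s0_ge0 t0_ge0 st1.
move: (e1) (max_le); have [u [v [uK vL eE]]] := KL_sum e.
move=> /(congr1 (fun r => r ^+ 2)); rewrite eE nrm_sum// expr1n => uv1.
have := st_max (nrm u) (nrm v); rewrite uv1 mulr1 => form_uv.
rewrite nrm_block_sqr// => max_le_sum.
have [Pv Su gP] := nrm_block_le uK vL.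
have cSu := ler_wpM2l (sqr_ge0 (nrm c)) Su.
have Pv_ge : p ^+ 2 * nrm v ^+ 2 <= nrm (P v) ^+ 2.
  by move: max_le_sum form_uv; rewrite /form /block_form; lra.
have cSu_ge : nrm c ^+ 2 * (p ^+ 2 * nrm u ^+ 2) <= nrm c ^+ 2 * nrm (S u) ^+ 2.
  by move: max_le_sum form_uv; rewrite /form /block_form; lra.
have [v0|v0] := eqVneq (nrm v) 0; last first.
  have v_gt0 : 0 < nrm v by rewrite lt_def v0 nrm_ge0.
  exists ((nrm v)^-1%:C *: v); rewrite PZ// !nrm_scale_inv//; split.
  - exact: LZ.
  - by rewrite divff.
  rewrite ler_pdivlMr// -(@ler_pXn2r _ 2%N)// ?nnegrE ?mulr_ge0 ?nrm_ge0//.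
  by rewrite exprMn.
have u1 : nrm u = 1.
  apply/eqP; rewrite -(@eqrXn2 _ 2%N)// ?nrm_ge0// expr1n.
  by rewrite -uv1 v0 expr0n addr0.
(* v = 0: for c <> 0 the vector S u / p does it, as |S u| = p *)
have [c0|c0] := eqVneq (nrm c) 0; last first.
  have Su_ge : p <= nrm (S u).
    rewrite -(@ler_pXn2r _ 2%N)// ?nnegrE ?nrm_ge0//.
    have : 0 < nrm c ^+ 2 by rewrite exprn_gt0// lt_def c0 nrm_ge0.
    by move=> c2; move: cSu_ge; rewrite ler_pM2l// u1 expr1n mulr1.
  exists (p^-1%:C *: S u); rewrite PZ ?nrm_scale_inv//; last exact: SL.
  split; first exact/LZ/SL.
    by rewrite ler_pdivrMr// mul1r (le_trans (S_le uK))// u1 mulr1.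
  rewrite ler_pdivlMr// -expr2.
  have -> : nrm (P (S u)) = nrm (P (S u)) * nrm u by rewrite u1 mulr1.
  apply: le_trans (Re_inner_le _ _).
  rewrite PS_adjoint//; last exact: SL.
  by rewrite inner_nrm/= ler_pXn2r ?nnegrE ?nrm_ge0.
(* v = 0 and c = 0: evaluating F_p at (|al|, p), the direction of the first row
   of the matrix with rows (|al|, p) and (0, |be|), shows that its maximum
   exceeds |al|^2 *)
have gE : nrm g = nrm al.
  by have /eqP := c0; rewrite nrm_eq0 /g => /eqP ->; rewrite mulr0 addr0.
have := st_max (nrm al) p.
have : form p s0 t0 <= nrm al ^+ 2.
  rewrite (le_trans max_le)// eE (le_trans (nrm_block_le_form uK vL))//.
  rewrite u1 v0 /form /block_form c0 !expr0n/= le_eqVlt; apply/orP; left.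
  by apply/eqP; ring.
have al0 := sqr_ge0 (nrm al); have be0 := mulr_ge0 (sqr_ge0 (nrm be)) (ltW p2).
move=> /(ler_wpM2r (addr_ge0 al0 (ltW p2))) h1 /le_trans/(_ h1).
have := mulr_gt0 p2 p2; have := mulr_ge0 al0 (ltW p2).
rewrite /form /block_form c0 gE expr0n/=; lra.
Qed.

(** With P attaining p at v, the lower bound for |T x| reaches the maximum of
    F_p, which bounds T from above. *)
Lemma norm_max_of_corner_max : 0 < p -> attains_max_on L P ->
  exists2 e, nrm e = 1 & forall x, nrm x <= 1 -> nrm (T x) <= nrm (T e).
Proof.
move=> p0 [v [vL v_le1] Pv_max].
have Pv : nrm (P v) = p.
  by apply/le_anti; rewrite le_p//= p_le.
have v1 : nrm v = 1.
  apply/le_anti; rewrite v_le1/= -(ler_pM2l p0) mulr1 -{1}Pv.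
  exact: P_le.
have [s [t [s0 t0 st1 st]]] := max_form.
have [|x x1] := form_le_nrm_block vL v1 _ s0 t0 st1; rewrite Pv// => Tx.
exists x => // y y1.
rewrite -(@ler_pXn2r _ 2%N)// ?nnegrE ?nrm_ge0// (le_trans (nrm_le_max st y))//.
rewrite (le_trans _ Tx)// ler_piMr ?form_ge0//.
by rewrite expr_le1// nrm_ge0.
Qed.

(** When P = 0, T acts as al on K and be on L, so the maximum is reached at a
    unit vector of one of them; either may be the zero space. *)
Lemma norm_max_of_zero_corner : p = 0 -> (exists x : H, x != 0) ->
  exists2 e, nrm e = 1 & forall x, nrm x <= 1 -> nrm (T x) <= nrm (T e).
Proof.
move=> p0 [x0 x0_neq0].
have TE0 u v : K u -> L v -> nrm (T (u + v)) ^+ 2 =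
    nrm al ^+ 2 * nrm u ^+ 2 + nrm be ^+ 2 * nrm v ^+ 2.
  move=> uK vL; rewrite nrm_block_sqr//.
  have : nrm (P v) <= 0 by rewrite (le_trans (P_le vL))// p0 mul0r.
  have : nrm (S u) <= 0 by rewrite (le_trans (S_le uK))// p0 mul0r.
  rewrite !le_eqVlt !(ltNge _ 0) !nrm_ge0 !orbF !nrm_eq0 => /eqP -> /eqP ->.
  by rewrite linear0r !nrm0 expr0n/= !mulr0 !addr0.
suff [u [v [uK vL uv1 uv_max]]] : exists u v, [/\ K u, L v,
    nrm u ^+ 2 + nrm v ^+ 2 = 1 &
    forall u' v', K u' -> L v' ->
      nrm al ^+ 2 * nrm u' ^+ 2 + nrm be ^+ 2 * nrm v' ^+ 2 <=
      (nrm al ^+ 2 * nrm u ^+ 2 + nrm be ^+ 2 * nrm v ^+ 2) *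
      (nrm u' ^+ 2 + nrm v' ^+ 2)].
  exists (u + v) => [|x x1].
    by apply/eqP; rewrite -(@eqrXn2 _ 2%N)// ?nrm_ge0// expr1n nrm_sum// uv1.
  have [u' [v' [u'K v'L xE]]] := KL_sum x.
  rewrite -(@ler_pXn2r _ 2%N)// ?nnegrE ?nrm_ge0// TE0//.
  rewrite xE TE0// (le_trans (uv_max _ _ u'K v'L))// -nrm_sum// -xE ler_piMr//.
    by rewrite addr_ge0// mulr_ge0 ?sqr_ge0.
  by rewrite expr_le1// nrm_ge0.
have [[u uK u1]|Ktriv] := unit_or_trivial KZ;
  have [[v vL v1]|Ltriv] := unit_or_trivial LZ.
- have [ab|/ltW ba] := leP (nrm al ^+ 2) (nrm be ^+ 2).
    exists 0, v; split; rewrite ?nrm0 ?v1 ?expr0n ?expr1n/= ?add0r// => u' v' _ _.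
    by have := ler_wpM2r (sqr_ge0 (nrm u')) ab; lra.
  exists u, 0; split; rewrite ?nrm0 ?u1 ?expr0n ?expr1n/= ?addr0// => u' v' _ _.
  by have := ler_wpM2r (sqr_ge0 (nrm v')) ba; lra.
- exists u, 0; split; rewrite ?nrm0 ?u1 ?expr0n ?expr1n/= ?addr0// => u' v' _ v'L.
  by rewrite (Ltriv _ v'L) expr0n /= !mulr0 mulr1 !addr0.
- exists 0, v; split; rewrite ?nrm0 ?v1 ?expr0n ?expr1n/= ?add0r// => u' v' u'K _.
  by rewrite (Ktriv _ u'K) expr0n /= !mulr0 mulr1 !add0r.
- have [u [v [uK vL xE]]] := KL_sum x0.
  case/negP: x0_neq0; rewrite -nrm_eq0 -sqrf_eq0 xE nrm_sum//.
  by rewrite (Ktriv _ uK) (Ltriv _ vL) expr0n addr0.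
Qed.

(** Since the criterion depends on the corner P alone, block operators that
    differ only in al, be and c attain their norms simultaneously. *)
Theorem attains_norm_block : (exists x : H, x != 0) ->
  attains_norm T <-> attains_max_on L P.
Proof.
move=> H_neq0; have [C TC] := T_bounded; rewrite (attains_normP TC).
have [p0|p0] := eqVneq p 0.
  split=> _; last exact: norm_max_of_zero_corner.
  exists 0; first by rewrite nrm0.
  by move=> w wL w1; rewrite P0 nrm0 -p0 le_p.
have p_gt0 : 0 < p by rewrite lt_def p0 p_ge0.
split=> [[e e1 Te]|]; first exact: corner_max_of_norm_max Te.
exact: norm_max_of_corner_max.
Qed.
End block_operator.

(** * Quadratic operators *)

Section quadratic_operator.
Variables (R : realType) (H : hilbertType R) (Q : {linear H -> H}) (a b : R[i]).
Hypothesis Q_bounded : bounded_operator Q.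
Hypothesis Q_quadratic : forall x, Q (Q x - b *: x) = a *: (Q x - b *: x).

Let K : set H := [set x | Q x - a *: x = 0].
Let L := orthogonal_set K.
Let P x := Q x - b *: x.
Let S x := adjoint Q x - a^*%C *: x.

Let adjE x y : inner (Q x) y = inner x (adjoint Q y).
Proof. exact: adjointP. Qed.

Let QK u : K u -> Q u = a *: u.
Proof. by move=> /eqP; rewrite subr_eq0 => /eqP. Qed.

Let KZ r u : K u -> K (r *: u).
Proof. by move=> /QK uK; rewrite /K/= linearZ/= uK !scalerA mulrC subrr. Qed.

Let LZ r v : L v -> L (r *: v).
Proof. by move=> vL u uK; rewrite innerZr vL// mulr0. Qed.

Let KL_sum x : exists u v, [/\ K u, L v & x = u + v].
Proof.
have [C C0 QC] := bounded_operatorP Q_bounded.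
apply: orthogonal_decomposition => //.
- apply: (@closed_ker _ _ _ _ (C + nrm a)) => y z.
  have -> : Q y - a *: y - (Q z - a *: z) = Q (y - z) - a *: (y - z).
    rewrite (linearB Q) scalerBr (opprB (Q z)) (opprB (a *: y)).
    by rewrite [a *: z - Q z]addrC addrACA [- _ + _]addrC.
  by rewrite (le_trans (nrmD _ _))// mulrDl lerD// nrmN nrmZ.
- by rewrite /K/= linear0 scaler0 subr0.
- by move=> u v /QK uK /QK vK; rewrite /K/= linearD/= uK vK scalerDr subrr.
Qed.

Let PK v : K (P v).
Proof. by rewrite /K/= Q_quadratic subrr. Qed.

(* S is the adjoint of Q - a, so its range is orthogonal to the kernel K. *)
Let SL u : K u -> L (S u).
Proof.
move=> _ k kK; rewrite /S innerBr -adjE innerZr conjcK QK// innerZl.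
by rewrite subrr.
Qed.

(* <(Q - b) x, v> = 0 for all x, since Q - b maps into K. *)
Let adjL v : L v -> adjoint Q v = b^*%C *: v.
Proof.
move=> vL; apply: inner_injr => x; rewrite -adjE innerZr conjcK.
apply/eqP; rewrite -subr_eq0 -innerZl -innerBl; apply/eqP.
exact: (vL _ (PK x)).
Qed.

Let adjD x y : adjoint Q (x + y) = adjoint Q x + adjoint Q y.
Proof. by apply: inner_injr => z; rewrite innerDr -!adjE innerDr. Qed.

Let PS_adjoint u v : K u -> L v -> inner (P v) u = inner v (S u).
Proof.
move=> uK vL; rewrite /P /S innerBl innerBr adjE innerZl innerZr.
by rewrite (innerC v u) (vL _ uK) conjc0 !mulr0.
Qed.

(** With respect to K and L, the operator is a block operator with corner
    P = Q - b. *)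
Lemma attains_norm_quadratic (c k : R[i]) : (exists x : H, x != 0) ->
  attains_norm (Q \+ c \*: adjoint Q \+ k \*: idfun) <->
  attains_max_on L P.
Proof.
apply: (@attains_norm_block _ _ K L P S _ (a + c * a^*%C + k)
  (b + c * b^*%C + k) c) => //.
- by move=> u v uK vL; exact: vL.
- by move=> r v _; rewrite /P linearZ/= scalerBr !scalerA mulrC.
- have [C C0 QC] := bounded_operatorP Q_bounded; exists (C + nrm b) => v _ v1.
  rewrite /P (le_trans (nrmD _ _))// nrmN nrmZ lerD//.
    by rewrite (le_trans (QC v))// ler_piMr.
  by rewrite ler_piMr// nrm_ge0.
have QE v : Q v = P v + b *: v by rewrite /P subrK.
have adjuE u : adjoint Q u = S u + a^*%C *: u by rewrite /S subrK.
move=> u v uK vL /=; rewrite linearD/= adjD (adjL vL) (QK uK) QE adjuE.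
rewrite !scalerDr !scalerDl !scalerA !addrA.
(* the order of the summands on the right, P v and S u being expanded *)
by rewrite [LHS](ACl (1*7*9*2*3*4*8*10*5*6)).
Qed.
End quadratic_operator.

Theorem theorem2p6 (R : realType) (H : hilbertType R)
    (H_nonzero : exists x : H, x != 0)
    (Q : {linear H -> H}) (Q_bounded : bounded_operator Q)
    (Q_quadratic : quadratic Q) :
  [<-> attains_norm Q ;
       forall c k : R[i],
         attains_norm (Q \+ c \*: adjoint Q \+ k \*: idfun) ;
       exists c k : R[i],
         attains_norm (Q \+ c \*: adjoint Q \+ k \*: idfun)].
Proof.
have [a [b Qab]] := Q_quadratic.
have Qab' x : Q (Q x - b *: x) = a *: (Q x - b *: x).
  by apply/eqP; rewrite -subr_eq0; apply/eqP; exact: Qab.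
have main c k := attains_norm_quadratic Q_bounded Qab' c k H_nonzero.
have Q00 : Q \+ 0 \*: adjoint Q \+ 0 \*: idfun = Q :> (H -> H).
  by apply/funext => x /=; rewrite !scale0r !addr0.
have mainQ := main 0 0; rewrite Q00 in mainQ.
tfae.
- by move=> /mainQ ? c k; apply/main.
- by move=> /(_ 0 0) ?; exists 0, 0.
- by move=> [c [k /main]] /mainQ.
Qed.
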